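(* (i) For $n\in\{4,5\}$, $E(\mathcal{P}_e(S_n))=E(\Delta_D(S_n))\subsetneq E(\Delta(S_n))$. (ii) For $n\geq 6$, $E(\mathcal{P}_e(S_n))\subsetneq E(\Delta_D(S_n))\subsetneq E(\Delta(S_n))$.
   Context: $S_n$ is the symmetric group; $E(\cdot)$ denotes edge set. The commuting graph $\Delta(G)$ has vertex set $G$ with distinct $x,y$ adjacent iff $xy=yx$. The enhanced power graph $\mathcal{P}_e(G)$ has vertex set $G$ with distinct $x,y$ adjacent iff $\langle x,y\rangle$ is cyclic. The deep commuting graph $\Delta_D(G)$ has vertex set $G$, distinct vertices adjacent iff their preimages commute in a Schur cover $\tilde G$ of $G$ (a central extension $\{e\}\to M(G)\to\tilde G\to G\to\{e\}$ with kernel contained in $Z(\tilde G)\cap[\tilde G,\tilde G]$, of maximal order; $M(G)$ the Schur multiplier). *)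

(* Defs.v *)
From mathcomp Require Import all_boot all_fingroup all_solvable.
Set Implicit Arguments. Unset Strict Implicit. Unset Printing Implicit Defensive.
Local Open Scope group_scope.

Definition edges (T : finType) (r : rel T) : {set {set T}} :=
  [set e : {set T} | [exists x : T, exists y : T,
     [&& x != y, r x y & e == [set x; y]]]].

Definition comm_adj (gT : finGroupType) : rel gT :=
  fun x y => x * y == y * x.

Definition epow_adj (gT : finGroupType) : rel gT :=
  fun x y => cyclic <<[set x; y]>>.

Definition stem_ext (gT hT : finGroupType) (G : {set gT}) (H : {group hT})
    (f : {morphism H >-> gT}) : Prop :=
  f @* H = G /\ 'ker f \subset 'Z(H) :&: [~: H, H].

Definition schur_cover (gT hT : finGroupType) (G : {set gT}) (H : {group hT})
    (f : {morphism H >-> gT}) : Prop :=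
  stem_ext G f /\
  forall (kT : finGroupType) (K : {group kT}) (g : {morphism K >-> gT}),
    stem_ext G g -> #|K| <= #|H|.

Definition deep_adj (gT hT : finGroupType) (H : {group hT})
    (f : {morphism H >-> gT}) : rel gT :=
  fun x y => [exists x' in H, exists y' in H,
               [&& f x' == x, f y' == y & x' * y' == y' * x']].

(* Main.v *)
Require Import Defs.
From mathcomp Require Import all_boot all_fingroup all_solvable all_algebra.
From mathcomp Require Import zify.
Set Implicit Arguments. Unset Strict Implicit. Unset Printing Implicit Defensive.
Import GRing.Theory.
Local Open Scope group_scope.

(* Commuting elements x, y of S_n are adjacent in the deep commuting graph iff
   the commutator of their lifts, which is a well-defined central element, is
   trivial. If the lifts of (0 1) and (2 3) commute in a stem extension, then by
   conjugation so do the lifts of all disjoint adjacent transpositions; lifts t_i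
   of the adjacent transpositions can be chosen to satisfy the braid relations,
   and they all have the same square. A coset count for the Coxeter relations then
   shows that the kernel meets the derived subgroup trivially, so the extension is
   trivial. This is impossible for a Schur cover, since a nontrivial stem
   extension exists: the vectors e_i - e_(i+1) of a Clifford algebra over F_3
   generate a double cover of S_n. So disjoint transpositions are not adjacent.

   For n <= 5 a noncyclic abelian subgroup contains a Klein four-group, in which
   the commutator pairing detects a pair of disjoint transpositions. For n >= 6 the
   disjoint 3-cycles (0 1 2) and (3 4 5) generate a noncyclic group, but the
   commutator of their lifts has order dividing 3 and is conjugate to its inverse. *)

(** * Coxeter relations *)

(** The family is indexed by [nat] and cut off at [m], so that index shifts need no ordinal
    casts. *)
Definition coxeter_gens (gT : finGroupType) (v : nat -> gT) (m : nat) : {set gT} :=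
  [set v (val i) | i : 'I_m].

Lemma coxeter_gensP (gT : finGroupType) (v : nat -> gT) m x :
  reflect (exists2 i, i < m & x = v i) (x \in coxeter_gens v m).
Proof.
apply: (iffP imsetP) => [[i _ ->]|[i lti ->]]; first by exists (val i); first exact: ltn_ord.
by exists (Ordinal lti).
Qed.

Lemma mem_coxeter_gen (gT : finGroupType) (v : nat -> gT) m i :
  i < m -> v i \in <<coxeter_gens v m>>.
Proof. by move=> lti; apply/mem_gen/coxeter_gensP; exists i. Qed.

Section Coxeter.

Variables (gT : finGroupType) (v : nat -> gT).

Fixpoint descending m k : gT := if k is k'.+1 then descending m k' * v (m - k') else 1.

(** All letters of the word have index at least [m - k + 1], and [i + k < m] keeps [i] at distance
    at least two from them. *)
Lemma descending_comm m k i :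
    (forall i j, i.+1 < j -> j <= m -> v i * v j = v j * v i) ->
  k <= m.+1 -> i + k < m -> descending m k * v i = v i * descending m k.
Proof.
move=> vC; elim: k => [|k IH] lek ltik /=; first by rewrite mul1g mulg1.
rewrite -mulgA -vC; [|lia|lia].
by rewrite mulgA IH ?mulgA //; lia.
Qed.

(** The factor [v i.+1] moves left past the letters below [v i], a braid relation turns it into
    [v i], and this moves left past the letters above [v i.+1]. *)
Lemma descending_shift m k i :
    (forall i, i < m -> v i * v i.+1 * v i = v i.+1 * v i * v i.+1) ->
    (forall i j, i.+1 < j -> j <= m -> v i * v j = v j * v i) ->
  k <= m.+1 -> i < m -> m < i + k ->
  descending m k * v i.+1 = v i * descending m k.
Proof.
move=> vB vC; elim: k => [|k IH] h1 h2 h3; first by lia.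
have [e|ne] := eqVneq (i + k) m.
  case: k e IH h1 h3 => [|k] e IH h1 h3; first by lia.
  rewrite /=; have -> : m - k = i.+1 by lia.
  have -> : m - k.+1 = i by lia.
  rewrite -!mulgA [v i.+1 * _]mulgA -vB // !mulgA.
  by rewrite descending_comm //; lia.
rewrite /= -mulgA vC; [|lia|lia].
by rewrite mulgA IH ?mulgA //; lia.
Qed.

(* The cosets T * v_m v_(m-1) ... v_(m-k+1), 0 <= k <= m + 1, of the subgroup T
   generated by the first m generators are permuted by right multiplication. *)
Lemma coxeter_card_exact m :
    (forall i, i < m -> v i * v i = 1) ->
    (forall i, i.+1 < m -> v i * v i.+1 * v i = v i.+1 * v i * v i.+1) ->
    (forall i j, i.+1 < j -> j < m -> v i * v j = v j * v i) ->
  #|<<coxeter_gens v m>>| <= (m.+1)`!.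
Proof.
elim: m => [|m IH] vI vB vC.
  suff -> : coxeter_gens v 0 = set0 by rewrite gen0 cards1.
  by apply/setP=> x; rewrite inE; apply/negP => /coxeter_gensP[].
pose T := <<coxeter_gens v m>>.
pose X := \bigcup_(k < m.+2) (T :* descending m k).
have sX : <<coxeter_gens v m.+1>> \subset X.
  have sN : <<coxeter_gens v m.+1>> \subset 'N(X | 'R).
    rewrite gen_subG; apply/subsetP=> _ /coxeter_gensP[i lti ->].
    rewrite !inE; apply/subsetP=> _ /bigcupP[[k ltk] _ /rcosetP[h Th ->]].
    rewrite inE /=.
    suff [k' [h' [ltk' Th' e]]] :
        exists k' h', [/\ k' < m.+2, h' \in T & descending m k * v i = h' * descending m k'].
      apply/bigcupP; exists (Ordinal ltk') => //=.
      by apply/rcosetP; exists (h * h'); [exact: groupM|rewrite -!mulgA e].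
    (* If [i + k = m], the generator lengthens the word; if [i + k = m + 1], it cancels the last
       letter. For smaller [i] it commutes through, and for larger [i] it comes out on the left with
       index lowered by one. *)
    have [e|n1] := eqVneq (i + k) m.
      exists k.+1, 1; split; [lia|exact: group1|].
      by rewrite mul1g /=; congr (_ * v _); lia.
    have [e|n2] := eqVneq (i + k) m.+1.
      case: k e ltk n1 => [|k] e ltk n1; first by lia.
      exists k, 1; split; [lia|exact: group1|].
      rewrite /= mul1g -mulgA; have -> : m - k = i by lia.
      by rewrite vI // mulg1.
    have [ltikm|leikm] := ltnP (i + k) m.
      exists k, (v i); split=> //; first by apply: mem_coxeter_gen; lia.
      by apply: descending_comm => //; lia.
    case: i lti n1 n2 leikm => [|i] lti n1 n2 leikm; first by lia.
    exists k, (v i); split=> //; first by apply: mem_coxeter_gen; lia.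
    by apply: descending_shift => //; try lia; move=> j ltj; apply: vB.
  (* [X] contains 1 and is stable under right translation, so it contains [g = 1 * g]. *)
  apply/subsetP=> g Tg.
  have /(astabs_act 1) := subsetP sN g Tg; rewrite /= mul1g => ->.
  by apply/bigcupP; exists ord0 => //=; apply/rcosetP; exists 1; rewrite ?mulg1.
apply: leq_trans (subset_leq_card sX) _.
apply: leq_trans (_ : \sum_(k < m.+2) #|T :* descending m k| <= _).
  rewrite /X; elim/big_rec2: _ => [|k a B _ le]; first by rewrite cards0.
  by apply: leq_trans (leq_card_setU _ _) _; rewrite leq_add2l.
under eq_bigr => k _ do rewrite card_rcoset.
rewrite sum_nat_const card_ord [in leqRHS]factS leq_mul2l /=.
apply: IH => *; [apply: vI|apply: vB|apply: vC] => //; lia.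
Qed.

End Coxeter.

(** Modulo the normal subgroup [A] the relations become exact, so the coset count applies to the
    quotient. *)
Lemma coxeter_card (gT : finGroupType) (v : nat -> gT) (A : {group gT}) m :
    A \subset <<coxeter_gens v m>> -> <<coxeter_gens v m>> \subset 'N(A) ->
    (forall i, i < m -> v i * v i \in A) ->
    (forall i, i.+1 < m ->
       v i * v i.+1 * v i * (v i.+1 * v i * v i.+1)^-1 \in A) ->
    (forall i j, i.+1 < j -> j < m -> v i * v j * (v j * v i)^-1 \in A) ->
  #|<<coxeter_gens v m>>| <= (m.+1)`! * #|A|.
Proof.
move=> sAK nAK vI vB vC; set K := <<_>> in sAK nAK *.
have Nv i : i < m -> v i \in 'N(A).
  by move=> lti; apply: (subsetP nAK); apply: mem_coxeter_gen.
have cosetE x y : x \in 'N(A) -> y \in 'N(A) -> x * y^-1 \in A ->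
    coset A x = coset A y.
  by move=> Nx Ny Axy; apply/rcoset_kercosetP => //; rewrite mem_rcoset.
have -> : #|K| = (#|K / A| * #|A|)%N.
  by rewrite -divg_normal ?divnK ?cardSg // /normal sAK.
rewrite leq_mul2r; apply/orP; right.
have -> : K / A = <<coxeter_gens (coset A \o v) m>>.
  rewrite /quotient morphim_gen; last first.
    by apply/subsetP=> _ /coxeter_gensP[i lti ->]; apply: Nv.
  congr <<_>>; apply/setP=> x; apply/morphimP/coxeter_gensP.
    by case=> _ _ /coxeter_gensP[i lti ->] ->; exists i.
  case=> i lti ->; exists (v i) => //; first exact: Nv.
  by apply/coxeter_gensP; exists i.
apply: coxeter_card_exact => /=.
- by move=> i lti; rewrite -morphM ?Nv //; apply/coset_id/vI.
- move=> i lti; rewrite -!morphM ?groupM ?Nv //; try lia.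
  by apply: cosetE; [| |exact: vB]; rewrite !groupM ?Nv //; lia.
move=> i j ltij ltj; rewrite -!morphM ?groupM ?Nv //; try lia.
by apply: cosetE; [| |exact: vC]; rewrite groupM ?Nv //; lia.
Qed.

(** * A double cover of the symmetric group *)

(** [inord] makes the family total on [nat]; the intended range is [i < m]. *)
Definition adj_tperm m (i : nat) : 'S_m.+1 := tperm (inord i) (inord i.+1).

Section AdjacentTranspositions.

Variable m : nat.
Local Notation s := (adj_tperm m).
Local Notation pt i := (inord i : 'I_m.+1).

Lemma eq_inord i j : i < m.+1 -> j < m.+1 -> (pt i == pt j) = (i == j).
Proof. by move=> lti ltj; rewrite -val_eqE /= !inordK. Qed.

Lemma uniq_inord4 i j : i.+1 < j -> j < m ->
  uniq [:: pt i; pt i.+1; pt j; pt j.+1].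
Proof. by move=> ltij ltj; rewrite /= !inE !eq_inord; lia. Qed.

Lemma adj_tpermK i : s i * s i = 1.
Proof. exact: tperm2. Qed.

Lemma adj_tpermV i : (s i)^-1 = s i.
Proof. exact: tpermV. Qed.

Lemma adj_tperm_conj_next i : i.+1 < m -> s i ^ s i.+1 = tperm (pt i) (pt i.+2).
Proof.
move=> lti; rewrite /adj_tperm tpermJ tpermL tpermD // eq_inord //; lia.
Qed.

Lemma adj_tperm_conj_prev i : i.+1 < m -> s i.+1 ^ s i = tperm (pt i) (pt i.+2).
Proof.
move=> lti; rewrite /adj_tperm tpermJ tpermR tpermD // eq_inord //; lia.
Qed.

Lemma adj_tperm_braid i : i.+1 < m -> s i * s i.+1 * s i = s i.+1 * s i * s i.+1.
Proof.
move=> lti; have := adj_tperm_conj_next lti; rewrite -(adj_tperm_conj_prev lti).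
by rewrite !conjgE !adj_tpermV !mulgA.
Qed.

Lemma adj_tperm_comm i j : i.+1 < j -> j < m -> s i * s j = s j * s i.
Proof.
move=> ltij ltj; apply/commgP/conjg_fixP.
by rewrite /adj_tperm tpermJ !tpermD // eq_inord //; lia.
Qed.

(** The transpositions (0 k) generate, and each arises from the previous one by conjugation with an
    adjacent transposition. *)
Lemma gen_adj_tperm : <<coxeter_gens s m>> = [set: 'S_m.+1].
Proof.
apply/eqP; rewrite eqEsubset subsetT -(gen_tperm (pt 0)) gen_subG.
apply/subsetP=> _ /imsetP[y _ ->].
suff gen0 k : k < m.+1 -> tperm (pt 0) (pt k) \in <<coxeter_gens s m>>.
  by have := gen0 (val y) (ltn_ord y); rewrite inord_val.
elim: k => [|k IH] ltk; first by rewrite tperm1 group1.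
case: k IH ltk => [|k] IH ltk; first exact: mem_coxeter_gen.
suff -> : tperm (pt 0) (pt k.+2) = tperm (pt 0) (pt k.+1) ^ s k.+1.
  by rewrite groupJ ?IH ?mem_coxeter_gen //; lia.
by rewrite tpermJ tpermL tpermD // eq_inord //; lia.
Qed.

End AdjacentTranspositions.

(** The induction doubles the matrix size: an old generator e becomes diag(e, -e), and the new one
    is the block swap, which anticommutes with all of these. *)
Lemma clifford_gens (R : nzRingType) n :
  exists N (e : nat -> 'M[R]_N.+1),
    (forall i, i < n -> (e i * e i = 1)%R) /\
    (forall i j, i < j -> j < n -> (e i * e j = - (e j * e i))%R).
Proof.
elim: n => [|n [N [e [eI eC]]]]; first by exists 0, (fun=> 0%R).
pose e' i : 'M[R]_(N.+1 + N.+1) :=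
  (if (i < n)%N then block_mx (e i) 0 0 (- e i) else block_mx 0 1%:M 1%:M 0)%R.
have e'I i : i < n.+1 -> (e' i *m e' i = 1%:M)%R.
  rewrite /e' => lti; have [ltin|leni] := ltnP i n.
    rewrite mulmx_block !mulmx0 !mul0mx !addr0 add0r mulmxN mulNmx opprK.
    by rewrite !mulmxE eI // -scalar_mx_block.
  by rewrite mulmx_block !mulmx0 !mul0mx !mulmx1 !addr0 add0r -scalar_mx_block.
have e'C i j : i < j -> j < n.+1 -> (e' i *m e' j = - (e' j *m e' i))%R.
  rewrite /e' => ltij ltj; have -> : i < n by lia.
  have [ltjn|lenj] := ltnP j n.
    rewrite !mulmx_block !mulmx0 !mul0mx !addr0 !add0r !mulmxN !mulNmx !opprK.
    by rewrite opp_block_mx !oppr0 !mulmxE eC.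
  rewrite !mulmx_block !mulmx0 !mul0mx !mulmx1 !mul1mx !addr0 !add0r.
  by rewrite opp_block_mx !oppr0 !opprK.
by exists (N + N.+1), e'; split; [exact: e'I | exact: e'C].
Qed.

(** * Differences of anticommuting involutions *)

Section AnticommutingInvolutions.

Local Open Scope ring_scope.

Variables (R : pzRingType) (a b c d : R).
Hypotheses (aI : a * a = 1) (bI : b * b = 1) (cI : c * c = 1).

Lemma anticomm_subr_sqr : a * b = - (b * a) -> (a - b) * (a - b) = 1 + 1.
Proof.
move=> ab; rewrite mulrBl !mulrBr aI bI ab opprK opprB.
by rewrite addrACA subrr addr0.
Qed.

Lemma anticomm_subr_adj :
    a * b = - (b * a) -> a * c = - (c * a) -> b * c = - (c * b) ->
  (a - b) * (b - c) + (b - c) * (a - b) = - (1 + 1).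
Proof.
move=> ab ac bc; rewrite !mulrBl !mulrBr bI ab ac bc !(opprD, opprK).
(* The mixed products are paired with their opposites; the two copies of [-1] coming from [b * b]
   remain. *)
rewrite [LHS](AC (2*2*(2*2)) (1*5*(2*7)*(4*8)*(3*6))) /=.
by rewrite addNr subrr addNr !add0r.
Qed.

Lemma anticomm_subr_disjoint :
    a * c = - (c * a) -> a * d = - (d * a) ->
    b * c = - (c * b) -> b * d = - (d * b) ->
  (a - b) * (c - d) = - ((c - d) * (a - b)).
Proof.
move=> ac ad bc bd; rewrite !mulrBl !mulrBr ac ad bc bd !(opprD, opprK).
by rewrite addrACA.
Qed.

(** Both sides of the braid relation equal [x + y]. *)
Lemma braid_of_sqrN1 (x y : R) :
  x * x = -1 -> y * y = -1 -> x * y + y * x = 1 -> x * y * x = y * x * y.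
Proof.
move=> xx yy xy.
have xyE : x * y = 1 - y * x by rewrite -xy addrK.
have yxE : y * x = 1 - x * y by rewrite -xy addrAC subrr add0r.
have -> : x * y * x = x + y by rewrite xyE mulrBl mul1r -mulrA xx mulrN1 opprK.
by rewrite yxE mulrBl mul1r -mulrA yy mulrN1 opprK addrC.
Qed.

End AnticommutingInvolutions.

(** With [1 + 1 = -1] no rescaling of the differences is necessary: their square 2 is -1, and the
    anticommutator -2 of two neighbours is 1. *)
Lemma transpositions_of_anticomm (R : pzRingType) m (e : nat -> R) :
    (1 + 1 = -1 :> R)%R ->
    (forall i, i < m.+1 -> (e i * e i = 1)%R) ->
    (forall i j, i < j -> j < m.+1 -> (e i * e j = - (e j * e i))%R) ->
    let t i := (e i - e i.+1)%R in
    [/\ forall i, i < m -> (t i * t i = -1)%R,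
        forall i, i.+1 < m -> (t i * t i.+1 * t i = t i.+1 * t i * t i.+1)%R
      & forall i j, i.+1 < j -> j < m -> (t i * t j = - (t j * t i))%R].
Proof.
move=> two eI eC t; have tI i : i < m -> (t i * t i = -1)%R.
  by move=> lti; rewrite -two; apply: anticomm_subr_sqr; [apply: eI|apply: eI|apply: eC]; lia.
split=> [//|i lti|i j ltij ltj].
  apply: braid_of_sqrN1; rewrite ?tI //; first by lia.
  rewrite anticomm_subr_adj; [by rewrite two opprK|apply: eI|apply: eC..]; lia.
by apply: anticomm_subr_disjoint; apply: eC; lia.
Qed.

(** The field ['F_3] supplies [1 + 1 = -1] and, being finite, a finite group of invertible
    matrices. *)
Lemma clifford_transpositions m :
  exists N (t : nat -> 'M['F_3]_N.+1),
    [/\ forall i, i < m -> (t i * t i = -1)%R,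
        forall i, i.+1 < m -> (t i * t i.+1 * t i = t i.+1 * t i * t i.+1)%R
      & forall i j, i.+1 < j -> j < m -> (t i * t j = - (t j * t i))%R].
Proof.
have [N [e [eI eC]]] := clifford_gens 'F_3 m.+1.
exists N, (fun i => e i - e i.+1)%R; apply: transpositions_of_anticomm => //.
have two : (1 + 1 = -1 :> 'F_3)%R by apply: val_inj.
by have := congr1 (@scalar_mx 'F_3 N.+1) two; rewrite raddfD raddfN.
Qed.

Lemma card_dom_morphim (gT hT : finGroupType) (H : {group hT})
    (f : {morphism H >-> gT}) :
  f @* H = [set: gT] -> #|H| = (#|[set: gT]| * #|'ker f|)%N.
Proof. by move=> fH; rewrite -fH card_morphim setIid mulnC Lagrange ?subsetIl. Qed.

(** The cover is generated by the pairs (s_i, t_i), with the first projection as covering map. Its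
    kernel is generated by [z = (1, -1)], a commutator because t_0 and t_2 anticommute. *)
Lemma sym_double_cover m : 3 <= m ->
  exists (kT : finGroupType) (K : {group kT}) (g : {morphism K >-> 'S_m.+1}),
    stem_ext [set: 'S_m.+1] g /\ (m.+1)`! < #|K|.
Proof.
move=> m_ge3; have [N [t [tI tB tC]]] := clifford_transpositions m.
have tU i : i < m -> t i \is a GRing.unit.
  by move=> lti; apply/GRing.unitrP; exists (- t i)%R; rewrite mulNr mulrN tI ?opprK.
pose U := {unit 'M['F_3]_N.+1}.
have valM (x y : U) : val (x * y) = (val x * val y)%R := FinRing.val_unitM x y.
(* The default 1 of [insubd] can occur only for [i >= m]. *)
have [u uE] : exists u : nat -> U, forall i, i < m -> val (u i) = t i.
  by exists (fun i => insubd (1 : U) (t i)) => i lti; rewrite val_insubd tU.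
have [e eE] : exists e : U, val e = (-1)%R.
  by exists (FinRing.unit _ (unitrN1 _)).
pose s := adj_tperm m.
pose v i : 'S_m.+1 * U := (s i, u i).
pose z : 'S_m.+1 * U := (1, e).
pose K := <<coxeter_gens v m>>.
have e2 : e * e = 1 by apply: val_inj; rewrite valM eE mulrNN mulr1.
have e_neq1 : e != 1.
  apply/eqP => /(congr1 val); rewrite eE => /matrixP/(_ ord0 ord0).
  by rewrite !mxE => /(congr1 val).
have z2 : z * z = 1 by congr (_, _) => //=; rewrite mulg1.
have vI i : i < m -> v i * v i = z.
  move=> lti; congr (_, _); first exact: adj_tpermK.
  by apply: val_inj; rewrite valM uE // tI.
have vB i : i.+1 < m -> v i * v i.+1 * v i = v i.+1 * v i * v i.+1.
  move=> lti; congr (_, _); first exact: adj_tperm_braid.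
  by apply: val_inj; rewrite !valM !uE; [exact: tB|lia..].
have vC i j : i.+1 < j -> j < m -> v i * v j = z * (v j * v i).
  move=> ltij ltj; congr (_, _); first by rewrite /= mul1g; apply: adj_tperm_comm.
  by apply: val_inj; rewrite !valM !uE ?eE ?mulN1r; [exact: tC|lia..].
have zC x : commute z x.
  case: x => x y; congr (_, _); first by rewrite /= mulg1 mul1g.
  by apply: val_inj; rewrite !valM eE mulN1r mulrN1.
have Kz : z \in K by rewrite -(vI 0) ?groupM ?mem_coxeter_gen //; lia.
have zder : z \in [~: K, K].
  have -> : z = [~ v 0, v 2].
    by apply: (mulgI (v 2 * v 0)); rewrite -commgC (vC 0) //; exact/esym/zC.
  by rewrite mem_commg ?mem_coxeter_gen //; lia.
pose A := <[z]>.
have leK : #|K| <= (m.+1)`! * #|A|.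
  apply: coxeter_card.
  - by rewrite cycle_subG.
  - by apply: cents_norm; apply/centsP=> x _ _ /cycleP[k ->]; apply/commuteX/commute_sym/zC.
  - by move=> i lti; rewrite vI ?cycle_id.
  - by move=> i lti; rewrite vB // mulgV group1.
  by move=> i j ltij ltj; rewrite vC // mulgK cycle_id.
pose g := [morphism of restrm (subsetT K) (@fst 'S_m.+1 U)].
exists _, [group of K], g.
have gK : g @* K = [set: 'S_m.+1].
  apply/eqP; rewrite eqEsubset subsetT -gen_adj_tperm gen_subG.
  apply/subsetP=> _ /coxeter_gensP[i lti ->].
  by apply: (mem_morphim g (x := v i)); apply: mem_coxeter_gen.
have cA : #|A| = 2.
  apply: nt_prime_order => //.
  by apply: contra e_neq1 => /eqP[->].
(* One inclusion is clear, and the coset count bounds the order of the kernel by that of [A]. *)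
have kerE : 'ker g = A.
  apply/eqP; rewrite eq_sym eqEcard cycle_subG; apply/andP; split.
    by apply/kerP.
  rewrite -(leq_pmul2l (fact_gt0 m.+1)); apply: leq_trans leK.
  by rewrite (card_dom_morphim gK) cardsT card_Sn.
split; last first.
  by rewrite (card_dom_morphim gK) cardsT card_Sn kerE cA ltn_Pmulr ?fact_gt0.
split=> //; rewrite kerE cycle_subG inE zder andbT.
by apply/centerP; split=> // y _; apply: zC.
Qed.

(** * Central extensions *)

Section CentralExtension.

Variables (gT hT : finGroupType) (H : {group hT}) (f : {morphism H >-> gT}).
Hypothesis fH : f @* H = [set: gT].
Hypothesis kerZ : 'ker f \subset 'Z(H).

Lemma lift_ex x : exists2 x', x' \in H & f x' = x.
Proof.
have : x \in f @* H by rewrite fH inE.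
by case/morphimP=> x' _ Hx' ->; exists x'.
Qed.

Lemma ker_comm k x : k \in 'ker f -> x \in H -> k * x = x * k.
Proof. by move=> /(subsetP kerZ)/centerP[_ cK] /cK. Qed.

Lemma ker_factor x y :
  x \in H -> y \in H -> f x = f y -> exists2 k, k \in 'ker f & x = k * y.
Proof.
move=> Hx Hy fxy; exists (x * y^-1); last by rewrite mulgKV.
by apply/kerP; rewrite ?groupM ?groupV // morphM ?groupV // morphV // fxy mulgV.
Qed.

(** Central factors drop out of a commutator, so the commutator of lifts depends only on the
    elements lifted. *)
Lemma commg_kerM k l x y : k \in 'ker f -> l \in 'ker f -> x \in H -> y \in H ->
  [~ k * x, l * y] = [~ x, y].
Proof.
move=> kk kl Hx Hy; have Hl : l \in H by apply: subsetP kl; apply: subsetIl.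
rewrite commMgJ (_ : [~ k, l * y] = 1); last first.
  by apply/eqP/commgP/(ker_comm kk); rewrite groupM.
rewrite conj1g mul1g commgMJ (_ : [~ x, l] = 1) ?conj1g ?mulg1 //.
by apply/eqP/commgP; apply/commute_sym/(ker_comm kl).
Qed.

(** Adjacency asks for some pair of commuting lifts; by independence of the lifts, any given pair
    decides it. *)
Lemma deep_adj_lift x y :
  x \in H -> y \in H -> deep_adj f (f x) (f y) = (x * y == y * x).
Proof.
move=> Hx Hy; apply/existsP/eqP => [[x'] |xy]; last first.
  by exists x; rewrite Hx; apply/existsP; exists y; rewrite Hy !eqxx xy eqxx.
case/andP=> Hx' /existsP[y'] /and4P[Hy' /eqP fx /eqP fy /eqP xy'].
have [k kk xE] := ker_factor Hx Hx' (esym fx).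
have [l kl yE] := ker_factor Hy Hy' (esym fy).
by apply/commgP; rewrite xE yE commg_kerM //; apply/commgP.
Qed.

Lemma deep_adj_sym x y : deep_adj f x y = deep_adj f y x.
Proof.
have [x' Hx <-] := lift_ex x; have [y' Hy <-] := lift_ex y.
by rewrite !deep_adj_lift // eq_sym.
Qed.

Lemma deep_adj_conj g x y : deep_adj f (x ^ g) (y ^ g) = deep_adj f x y.
Proof.
have [x' Hx <-] := lift_ex x; have [y' Hy <-] := lift_ex y.
have [g' Hg <-] := lift_ex g.
rewrite -!morphJ // !deep_adj_lift ?groupJ // -!conjMg.
by rewrite (inj_eq (conjg_inj _)).
Qed.

Lemma deep_adj_comm x y : deep_adj f x y -> x * y = y * x.
Proof.
have [x' Hx <-] := lift_ex x; have [y' Hy <-] := lift_ex y.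
by rewrite deep_adj_lift // -!morphM // => /eqP->.
Qed.

(** Commuting lifts of [x] and [y] generate an abelian group that maps onto the group generated by
    [x] and [y]. *)
Lemma deep_adj_gen x y u v : deep_adj f x y ->
  u \in <<[set x; y]>> -> v \in <<[set x; y]>> -> deep_adj f u v.
Proof.
have [x' Hx <-] := lift_ex x; have [y' Hy <-] := lift_ex y.
rewrite deep_adj_lift // => /eqP xy.
have sH : [set x'; y'] \subset H by rewrite subUset !sub1set Hx.
have -> : [set f x'; f y'] = f @* [set x'; y'] by rewrite morphimU !morphim_set1.
rewrite -morphim_gen // => /morphimP[u' Hu Gu ->] /morphimP[v' Hv Gv ->].
rewrite deep_adj_lift //; apply/eqP.
suff /centsP cG : abelian <<[set x'; y']>> by apply: cG.
rewrite abelian_gen; apply/centsP=> a /set2P[]-> b /set2P[]-> //.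
Qed.

(** Powers of one lift of a generator serve as commuting lifts. *)
Lemma deep_adj_cyclic x y : cyclic <<[set x; y]>> -> deep_adj f x y.
Proof.
case/cyclicP=> g gE; have [g' Hg fg] := lift_ex g.
have /cycleP[i ->] : x \in <[g]> by rewrite -gE mem_gen ?set21.
have /cycleP[j ->] : y \in <[g]> by rewrite -gE mem_gen ?set22.
rewrite -fg -!morphX // deep_adj_lift ?groupX //.
by apply/eqP; apply: commuteX2.
Qed.

(* Conjugation by a lift of v exchanges a lift of a and a lift of b, so it
   reverses their product. *)
Lemma deep_adj_swap a b v :
  v * v = 1 -> a ^ v = b -> deep_adj f (a * b) v -> deep_adj f a b.
Proof.
move=> vv <-; have [a' Ha <-] := lift_ex a.
have [v' Hv fv] := lift_ex v; rewrite -fv -morphJ // -morphM ?groupJ //.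
have Hb : a' ^ v' \in H by rewrite groupJ.
rewrite !(deep_adj_lift, groupM Ha Hb) // => /eqP cv; apply/eqP.
(* Since [v * v = 1], the square of [v'] is central, so conjugating twice by [v'] fixes [a']. *)
have kv : v' * v' \in 'ker f by apply/kerP; rewrite ?groupM // morphM // fv.
have bv : a' ^ v' * v' = v' * a'.
  by rewrite conjgC -conjgM conjgE -(ker_comm kv Ha) mulKg.
by apply: (mulgI v'); rewrite -cv -mulgA bv conjgE !mulgA mulgV mul1g.
Qed.

(* The commutator of the lifts is central, has order dividing 3, and is
   inverted by conjugation by a lift of g. *)
Lemma deep_adj_inv g x y :
    x * y = y * x -> x ^+ 3 = 1 -> x ^ g = x -> y ^ g = y^-1 -> deep_adj f x y.
Proof.
have [x' Hx <-] := lift_ex x; have [y' Hy <-] := lift_ex y.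
have [g' Hg <-] := lift_ex g => xy x3 xg yg.
have comm1 z w : z \in 'ker f -> w \in H -> [~ z, w] = 1.
  by move=> kz Hw; apply/eqP/commgP/ker_comm.
have kc : [~ x', y'] \in 'ker f.
  by apply/kerP; rewrite ?groupR // morphR //; apply/eqP/commgP.
(* The cube equals [[~ x' ^+ 3, y']], whose first entry lies in the kernel. *)
have c3 : [~ x', y'] ^+ 3 = 1.
  rewrite -commXg; last by apply/commute_sym/ker_comm.
  by apply: comm1 => //; apply/kerP; rewrite ?groupX ?morphX.
have [|||k kk xE] := @ker_factor (x' ^ g') x'; rewrite ?groupJ ?morphJ //.
have [|||l kl yE] := @ker_factor (y' ^ g') y'^-1; rewrite ?groupJ ?groupV ?morphJ ?morphV //.
have cJ : [~ x', y'] ^ g' = [~ x', y'] by apply/conjg_fixP/eqP/comm1.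
have cV : [~ x', y'^-1] * [~ x', y'] = 1.
  have /conjg_fixP {1}<- : [~ [~ x', y'], y'^-1] == 1 by rewrite comm1 ?groupV.
  by rewrite -commgMJ mulgV commg1.
(* Conjugation by [g'] fixes the central commutator but also carries it to [[~ x', y'^-1]], its
   inverse. *)
have cc : [~ x', y'] * [~ x', y'] = 1.
  by rewrite -{1}cJ conjRg xE yE commg_kerM ?groupV.
rewrite deep_adj_lift //; apply/eqP/commgP.
by rewrite -c3 2!expgS expg1 cc mulg1.
Qed.

End CentralExtension.

Lemma perm_4transitive (T : finType) (a b c d a' b' c' d' : T) :
    uniq [:: a; b; c; d] -> uniq [:: a'; b'; c'; d'] ->
  exists g : {perm T}, [/\ g a = a', g b = b', g c = c' & g d = d'].
Proof.
move=> U U'; have le4 : 4 <= #|T|.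
  by rewrite -[4]/(size [:: a; b; c; d]) -(card_uniqP U) max_card.
have tr4 := ntransitive_weak le4 (Sym_trans T).
have dt (t : 4.-tuple T) : uniq t -> t \in 4.-dtuple([set: T]).
  by move=> Ut; rewrite inE Ut; apply/subsetP => x; rewrite inE.
have := atransP2 tr4 (dt [tuple a; b; c; d] U) (dt [tuple a'; b'; c'; d'] U').
case=> g _ /(congr1 val)/= [].
by exists g; split.
Qed.

(** * Central extensions of symmetric groups *)

Section SymmetricCentralExtension.

Variables (m : nat) (hT : finGroupType) (H : {group hT}) (f : {morphism H >-> 'S_m.+1}).
Hypothesis fH : f @* H = [set: 'S_m.+1].
Hypothesis kerZ : 'ker f \subset 'Z(H).
Local Notation s := (adj_tperm m).

(** By 4-transitivity, all ordered pairs of disjoint transpositions are simultaneously conjugate. *)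
Lemma deep_adj_disjoint_tperm a b c d a' b' c' d' :
    uniq [:: a; b; c; d] -> uniq [:: a'; b'; c'; d'] ->
  deep_adj f (tperm a b) (tperm c d) -> deep_adj f (tperm a' b') (tperm c' d').
Proof.
move=> U U'; have [g [<- <- <- <-]] := perm_4transitive U U'.
by rewrite -!tpermJ deep_adj_conj.
Qed.

(* t_(i+1) is the conjugate of t_i by the inverse of t_i u, for an arbitrary lift u
   of s_(i+1); since u differs from t_(i+1) by a central element, this conjugation
   relation is the braid relation. *)
Lemma braid_lifts : 1 <= m ->
  exists t : nat -> hT,
    [/\ forall i, t i \in H, forall i, i < m -> f (t i) = s i,
        forall i, i.+1 < m -> t i * t i.+1 * t i = t i.+1 * t i * t i.+1
      & forall i, i < m -> t i * t i = t 0 * t 0].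
Proof.
move=> m_gt0.
have [tau tauP] : exists tau : 'S_m.+1 -> hT, forall x, tau x \in H /\ f (tau x) = x.
  apply: (fin_all_exists (P := fun x u => u \in H /\ f u = x)) => x.
  by have [x' Hx fx] := lift_ex fH x; exists x'.
have tauH x : tau x \in H by case: (tauP x).
have tauK x : f (tau x) = x by case: (tauP x).
have [t [t0 tS]] : exists t : nat -> hT, t 0 = tau (s 0) /\
    forall i, t i.+1 = t i ^ (t i * tau (s i.+1))^-1.
  by exists (fix t i := if i is j.+1 then t j ^ (t j * tau (s j.+1))^-1 else tau (s 0)).
have tH i : t i \in H by elim: i => [|i IH]; rewrite ?t0 // tS groupJ ?groupV ?groupM.
have tf i : i < m -> f (t i) = s i.
  elim: i => [|i IH] lti; rewrite ?t0 // tS; have {}IH := IH (ltnW lti).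
  rewrite morphJ ?groupV ?groupM // morphV ?groupM // morphM // tauK IH.
  rewrite conjgE invgK mulgA; apply: (canLR (mulgK _)).
  by rewrite !mulgA adj_tperm_braid.
have tauE i : i < m -> exists2 k, k \in 'ker f & tau (s i) = k * t i.
  move=> lti; exists (tau (s i) * (t i)^-1); last by rewrite mulgKV.
  apply/kerP; rewrite ?groupM ?groupV //.
  by rewrite morphM ?groupV // morphV // tauK tf // mulgV.
have tB i : i.+1 < m -> t i * t i.+1 * t i = t i.+1 * t i * t i.+1.
  move=> lti; have [k kk kE] := tauE _ lti.
  have kP x : x \in H -> k * x = x * k by apply: (ker_comm kerZ).
  have : t i.+1 * (t i * tau (s i.+1)) = t i * tau (s i.+1) * t i.
    by rewrite {1}tS; apply/esym/conjgCV.
  have -> : t i * tau (s i.+1) = k * (t i * t i.+1).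
    by rewrite kE mulgA -kP // mulgA.
  by rewrite mulgA -kP // -!mulgA => /mulgI->.
exists t; split=> //.
(* The square of t_0 is central, and each later square is a conjugate of the one before. *)
have k0 : t 0 * t 0 \in 'ker f.
  by apply/kerP; rewrite ?groupM // morphM // tf // adj_tpermK.
elim=> [|i IH] lti //; rewrite tS -conjMg IH ?(ltnW lti) //.
by apply/conjg_fixP/commgP; apply: (ker_comm kerZ) => //; rewrite groupV groupM.
Qed.

(* With a = t_0^2 of order k and c a generator of the cyclic group of order 2k, the
   pairs (t_i, c) satisfy the Coxeter relations modulo w = (a, c^2), so that the
   group they generate meets the kernel in <[w]>; the second component, being
   trivial on commutators, separates <[w]> from the derived subgroup. *)
Lemma trivial_ker_of_deep_adj : 3 <= m ->
  'ker f \subset [~: H, H] -> deep_adj f (s 0) (s 2) -> 'ker f = 1.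
Proof.
move=> m_ge3 kerD deep02; have m_gt0 : 0 < m by apply: leq_trans m_ge3.
have [t [tH tf tB tI]] := braid_lifts m_gt0.
have tC i j : i.+1 < j -> j < m -> t i * t j = t j * t i.
  move=> ltij ltj; apply/eqP; rewrite -(deep_adj_lift kerZ (tH i) (tH j)) !tf; [|lia|lia].
  by apply: deep_adj_disjoint_tperm deep02; apply: uniq_inord4.
pose a := t 0 * t 0.
have ka : a \in 'ker f.
  by apply/kerP; rewrite ?groupM // morphM // tf // adj_tpermK.
have aC x : x \in H -> a * x = x * a by apply: (ker_comm kerZ).
(* The form ['I_q.+2] displays the cyclic group of order [2 * #[a]] as nontrivial, as its generator
   [Zp1] requires. *)
pose q := (#[a]).*2.-2.
have qE : q.+2 = (#[a]).*2 by rewrite /q; have := order_gt0 a; lia.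
pose C := 'I_q.+2; pose c : C := Zp1.
have cC (x y : C) : x * y = y * x by apply: FinRing.zmod_mulgC.
pose u i : hT * C := (t i, c).
pose w : hT * C := (a, c * c).
pose K := <<coxeter_gens u m>>.
have uI i : i < m -> u i * u i = w by move=> lti; congr (_, _); exact: tI.
have Kw : w \in K by rewrite -(uI 0) ?groupM ?mem_coxeter_gen //; lia.
have sKH : K \subset (@fst hT C) @*^-1 H.
  rewrite gen_subG; apply/subsetP=> _ /coxeter_gensP[i lti ->].
  by rewrite !inE /=.
have KH x : x \in K -> x.1 \in H by move/(subsetP sKH); rewrite !inE.
have wC : K \subset 'C[w].
  apply/subsetP=> x Kx; apply/cent1P; congr (_, _); last exact: cC.
  exact/esym/aC/KH.
pose A := <[w]>.
have leK : #|K| <= (m.+1)`! * #|A|.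
  apply: coxeter_card.
  - by rewrite cycle_subG.
  - by apply: cents_norm; rewrite centsC cycle_subG -sub_cent1.
  - by move=> i lti; rewrite uI ?cycle_id.
  - move=> i lti; suff -> : u i * u i.+1 * u i = u i.+1 * u i * u i.+1.
      by rewrite mulgV group1.
    by congr (_, _); apply: tB.
  move=> i j ltij ltj; suff -> : u i * u j = u j * u i by rewrite mulgV group1.
  by congr (_, _); apply: tC.
pose phi := [morphism of restrm sKH (f \o @fst hT C)].
have phiE x : phi x = f x.1 by [].
have phiK : phi @* K = [set: 'S_m.+1].
  apply/eqP; rewrite eqEsubset subsetT -gen_adj_tperm gen_subG.
  apply/subsetP=> _ /coxeter_gensP[i lti ->]; rewrite -tf //.
  by apply: (mem_morphim phi (x := u i)); apply: mem_coxeter_gen.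
have kerE : 'ker phi = A.
  apply/eqP; rewrite eq_sym eqEcard cycle_subG; apply/andP; split.
    by apply/kerP; rewrite // phiE; apply/mker.
  rewrite -(leq_pmul2l (fact_gt0 m.+1)); apply: leq_trans leK.
  by rewrite (card_dom_morphim phiK) cardsT card_Sn.
have lift h : h \in H -> exists p z, [/\ p \in K, z \in 'ker f & h = z * p.1].
  move=> Hh; have : f h \in phi @* K by rewrite phiK inE.
  case/morphimP=> p _ Kp; rewrite phiE => fh.
  exists p, (h * p.1^-1); rewrite mulgKV; split=> //.
  have Hp := KH _ Kp.
  by apply/kerP; rewrite ?groupM ?groupV // morphM ?groupV // morphV // fh mulgV.
(* Every element of [H] is a central element times a first component from [K], and the central
   factors disappear in commutators. *)
have sD : [~: H, H] \subset (@fst hT C) @* [~: K, K].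
  rewrite gen_subG; apply/subsetP=> _ /imset2P[x y Hx Hy ->].
  have [p [z [Kp kz ->]]] := lift x Hx; have [p' [z' [Kp' kz' ->]]] := lift y Hy.
  suff -> : [~ z * p.1, z' * p'.1] = [~ p, p'].1.
    by apply: (mem_morphim (fst_morphism hT C)); rewrite ?inE ?mem_commg.
  by rewrite (commg_kerM kerZ) ?KH.
have D1 p : p \in [~: K, K] -> p.2 = 1.
  suff : [~: K, K] \subset 'ker (@snd hT C) by move/subsetP=> sker /sker/mker.
  rewrite gen_subG; apply/subsetP=> _ /imset2P[x y Kx Ky ->].
  apply/kerP; rewrite ?inE //=; apply/eqP/commgP; exact: cC.
apply/trivgP/subsetP=> h kh; rewrite inE.
have /morphimP[p _ Dp hE] := subsetP sD h (subsetP kerD h kh).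
have Kp : p \in K by apply: subsetP Dp; apply: der1_subG.
have : p \in 'ker phi by apply/kerP; rewrite // phiE -[p.1]/(fst p) -hE; apply/mker.
rewrite kerE => /cycleP[k pE].
have p1 : p.1 = a ^+ k by rewrite pE; apply: (morphX (fst_morphism hT C)); rewrite inE.
have p2 : p.2 = (c * c) ^+ k by rewrite pE; apply: (morphX (snd_morphism hT C)); rewrite inE.
(* The second component of [p = w ^+ k] is both [c ^+ (2 * k)] and 1; hence [#[a]] divides [k], and
   [h = a ^+ k] is trivial. *)
have : (#[a]).*2 %| k.*2.
  rewrite -qE -[q.+2]order_Zp1 order_dvdn -/c -muln2 mulnC expgM.
  by apply/eqP; rewrite -[c ^+ 2]/(c * c) -p2 D1.
rewrite -!muln2 dvdn_pmul2r // order_dvdn => /eqP ak.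
by apply/eqP; rewrite hE -ak -p1.
Qed.

End SymmetricCentralExtension.

(** A trivial kernel would make the cover smaller than the double cover, against maximality. *)
Lemma schur_cover_not_deep m (hT : finGroupType) (H : {group hT})
    (f : {morphism H >-> 'S_m.+1}) :
  3 <= m -> schur_cover [set: 'S_m.+1] f -> ~~ deep_adj f (adj_tperm m 0) (adj_tperm m 2).
Proof.
move=> m_ge3 [[fH kerZD] maxH]; apply/negP => deep02.
have [kerZ kerD] := subsetIP kerZD.
have ker1 := trivial_ker_of_deep_adj fH kerZ m_ge3 kerD deep02.
have [kT [K [g [stemg ltK]]]] := sym_double_cover m_ge3.
have := leq_trans ltK (maxH _ _ _ stemg).
by rewrite (card_dom_morphim fH) cardsT card_Sn ker1 cards1 muln1 ltnn.
Qed.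

(** * Abelian subgroups on at most five points *)

Lemma mul_involutions (gT : groupType) (x y : gT) :
  x * x = 1 -> y * y = 1 -> x * y = y * x -> (x * y) * (x * y) = 1.
Proof. by move=> xx yy xy; rewrite {2}xy mulgA -(mulgA x) yy mulg1 xx. Qed.

Section FivePoints.

Variable T : finType.
Hypothesis leT5 : #|T| <= 5.
Implicit Types (g u v : {perm T}) (a b c d x : T).

(** A moved point outside the invariant four-set would have its image outside as well, giving six
    points. *)
Lemma involution_fix_outside g a b c d x :
    uniq [:: a; b; c; d] -> g * g = 1 ->
    {in [:: a; b; c; d], forall y, g y \in [:: a; b; c; d]} ->
  x \notin [:: a; b; c; d] -> g x = x.
Proof.
move=> U gg gS Sx; have gK y : g (g y) = y by rewrite -permM gg perm1.
apply/eqP; apply: contraT => ne.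
have Sgx : g x \notin [:: a; b; c; d] by apply: contra Sx => /gS; rewrite gK.
have : uniq [:: g x, x & [:: a; b; c; d]] by rewrite 2!cons_uniq inE negb_or ne Sgx Sx.
move/card_uniqP => card6.
by have := leq_trans (max_card (mem [:: g x, x & [:: a; b; c; d]])) leT5; rewrite card6.
Qed.

Lemma involution_eq g (h : {perm T}) a b c d :
    uniq [:: a; b; c; d] -> g * g = 1 -> h * h = 1 ->
    {in [:: a; b; c; d], forall y, g y \in [:: a; b; c; d]} ->
    [/\ g a = h a, g b = h b, g c = h c & g d = h d] ->
  g = h.
Proof.
move=> U gg hh gS [ga gb gc gd].
have gh : {in [:: a; b; c; d], g =1 h}.
  by move=> y; rewrite !inE => /or4P[]/eqP->.
apply/permP=> x; have [/gh //|Sx] := boolP (x \in [:: a; b; c; d]).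
rewrite !(involution_fix_outside U) // => y Sy.
by rewrite -gh // gS.
Qed.

Lemma tperm_disjoint a b c d : uniq [:: a; b; c; d] ->
  [/\ tperm a b c = c, tperm a b d = d, tperm c d a = a & tperm c d b = b].
Proof.
rewrite /= !inE !negb_or !andbT => /and3P[/and3P[ab ac ad] /andP[bc bd] cd].
by split; rewrite tpermD // eq_sym.
Qed.

(** A noncyclic abelian group contains an elementary abelian group of order [p ^ 2] for some prime
    [p]; the order of the symmetric group forces [p = 2]. *)
Lemma noncyclic_abelian_involutions (A : {group {perm T}}) :
    abelian A -> ~~ cyclic A ->
  exists u v, [/\ u \in A, v \in A, u * u = 1 & v * v = 1] /\
              [/\ u != 1, v != 1 & u != v].
Proof.
move=> cAA; rewrite abelian_rank1_cyclic // -ltnNge.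
have [p pr_p ->] := rank_witness A; case/p_rank_geP=> E /pnElemP[sEA abE oE].
have oEp : #|E| = (p ^ 2)%N by rewrite (card_pgroup (abelem_pgroup abE)) oE.
(* Here 120 = 5!, and 2 is the only prime whose square divides it. *)
have dvd120 : p ^ 2 %| 120.
  apply: dvdn_trans (_ : (#|T|)`! %| 120).
    by rewrite -oEp -card_Sym; apply/cardSg/subsetT.
  by case: #|T| leT5 => [|[|[|[|[|[|]]]]]].
have p2 : p = 2.
  have : p \in primes 120 by rewrite mem_primes pr_p /= (dvdn_trans _ dvd120) ?dvdn_exp.
  by rewrite !inE => /or3P[]/eqP e //; rewrite e in dvd120.
have sq g : g \in E -> g * g = 1.
  by move=> Eg; have [_ /(_ g Eg)] := abelemP pr_p abE; rewrite p2.
have pick g h : exists2 k, k \in E & k \notin [set g; h].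
  apply/subsetPn; apply: contraL (leqnn #|E|) => /subset_leq_card leE.
  by rewrite -ltnNge {2}oEp p2 (leq_ltn_trans leE) // cards2; case: (g != h).
have [u Eu] := pick 1 1; rewrite !inE orbb => u1.
have [v Ev] := pick 1 u; rewrite !inE negb_or eq_sym => /andP[v1 uv].
by exists u, v; split; split; rewrite ?sq ?(subsetP sEA) // 1?eq_sym.
Qed.

(** Take [u] moving [a] to [b]. If [v] takes [a] outside {a, b}, then [u] is a double transposition
    whose two factors [v] exchanges. Otherwise [A] contains two disjoint transpositions. *)
Lemma noncyclic_abelian_5 (A : {group {perm T}}) :
    abelian A -> ~~ cyclic A ->
  exists a b c d, uniq [:: a; b; c; d] /\
    (tperm a b \in A /\ tperm c d \in A \/
     tperm a b * tperm c d \in A /\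
     exists2 v, v \in A & [/\ v * v = 1, v a = c & v b = d]).
Proof.
move=> cAA /(noncyclic_abelian_involutions cAA)[u [v [[Au Av uu vv] [u1 v1 uv1]]]].
have moved g : g != 1 -> exists x, g x != x.
  move=> g1; apply/existsP; apply: contraR g1 => /existsPn fixg.
  by apply/eqP/permP => x; rewrite perm1; apply/eqP; rewrite -[_ == _]negbK fixg.
have invK g : g * g = 1 -> forall x, g (g x) = x.
  by move=> gg x; rewrite -permM gg perm1.
have comm g h : g \in A -> h \in A -> forall x, g (h x) = h (g x).
  by move=> Ag Ah x; rewrite -!permM (centsP cAA _ Ah _ Ag).
have [a ua] := moved u u1; pose b := u a.
have ub : u b = a by apply: invK.
have [vab | vab] := boolP (v a \in [:: a; b]); last first.
  pose c := v a; pose d := v b.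
  have uc : u c = d by rewrite /c comm.
  have ud : u d = c by rewrite /d comm // ub.
  have vc : v c = a by apply: invK.
  have vd : v d = b by apply: invK.
  move: vab; rewrite !inE negb_or -/c => /andP[ca cb].
  have U : uniq [:: a; b; c; d].
    rewrite /= !inE !negb_or !andbT [a == b]eq_sym ua [a == c]eq_sym ca [b == c]eq_sym cb /=.
    apply/and3P; split.
    - by apply: contra cb => /eqP e; rewrite -vd -e.
    - by apply: contra ca => /eqP e; rewrite -ub e ud.
    by apply: contra ua => /eqP e; rewrite -/b -vd -e vc.
  exists a, b, c, d; split=> //; right; split; last by exists v.
  have [abc abd cda cdb] := tperm_disjoint U.
  suff <- : u = tperm a b * tperm c d by [].
  apply: (involution_eq U) => //.
  - apply: mul_involutions; rewrite ?tperm2 //.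
    by apply/commgP/conjg_fixP; rewrite tpermJ cda cdb.
  - by move=> y; rewrite !inE => /or4P[]/eqP->; rewrite ?ub ?uc ?ud eqxx ?orbT.
  by rewrite !permM tpermL tpermR abc abd cda cdb tpermL tpermR.
(* Either [v] fixes [a], or [v] agrees with [u] at [a] and [u * v] fixes it. *)
have [w [Aw ww w1 wa]] : exists w, [/\ w \in A, w * w = 1, w != 1 & w a = a].
  move: vab; rewrite !inE => /orP[]/eqP va; first by exists v.
  exists (u * v); split; first exact: groupM.
  - exact: mul_involutions uu vv (centsP cAA _ Au _ Av).
  - by rewrite -eq_invg_mul; have /eqP-> : u^-1 == u by rewrite eq_invg_mul uu.
  by rewrite permM -/b -va invK.
have wb : w b = b by rewrite /b comm // wa.
have [c wc] := moved w w1; pose d := w c.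
have wd : w d = c by apply: invK.
have [ca cb] : c != a /\ c != b by split; apply: contra wc => /eqP->; rewrite ?wa ?wb.
have [da db] : d != a /\ d != b.
  by split; [apply: contra ca | apply: contra cb] => /eqP e; rewrite -wd e ?wa ?wb.
have U : uniq [:: a; b; c; d].
  rewrite /= !inE !negb_or !andbT ![a == _]eq_sym ua ca da.
  by rewrite ![b == _]eq_sym cb db eq_sym wc.
have [abc abd cda cdb] := tperm_disjoint U.
have wE : w = tperm c d.
  apply: (involution_eq U); rewrite ?tperm2 //.
    by move=> y; rewrite !inE => /or4P[]/eqP->; rewrite ?wa ?wb ?wd eqxx ?orbT.
  by rewrite tpermL tpermR cda cdb.
exists a, b, c, d; split=> //; left; split; last by rewrite -wE.
(* Commuting with [w = (c d)], [u] preserves the support {c, d}; the two cases give (a b) as [u] or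
   as [u * w]. *)
have [ucE | ucE] : u c = c \/ u c = d.
  have [->|uc] := eqVneq (u c) c; first by left.
  have [->|ud] := eqVneq (u c) d; first by right.
  have : w (u c) = u c by rewrite wE tpermD // eq_sym.
  by rewrite comm // => /perm_inj/eqP; rewrite (negPf wc).
- have ud : u d = d by rewrite /d comm // ucE.
  suff <- : u = tperm a b by [].
  apply: (involution_eq U); rewrite ?tperm2 //.
    by move=> y; rewrite !inE => /or4P[]/eqP->; rewrite ?ub ?ucE ?ud eqxx ?orbT.
  by rewrite tpermL tpermR abc abd.
have ud : u d = c by rewrite -ucE invK.
suff <- : u * w = tperm a b by rewrite groupM.
apply: (involution_eq U); rewrite ?tperm2 //.
- exact: mul_involutions uu ww (centsP cAA _ Au _ Aw).
- by move=> y; rewrite !inE => /or4P[]/eqP->; rewrite permM ?ub ?ucE ?ud ?wa ?wb ?wd eqxx ?orbT.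
by rewrite !permM ub ucE ud wa wb wd tpermL tpermR abc abd.
Qed.

End FivePoints.

(** * Disjoint 3-cycles on at least six points *)

Section SixPoints.

Variable m : nat.
Hypothesis m_ge5 : 5 <= m.
Local Notation s := (adj_tperm m).

Lemma order_adj_tpermM i : i.+1 < m -> #[s i * s i.+1] = 3.
Proof.
move=> lti; have ssK g j : g * s j * s j = g by rewrite -mulgA adj_tpermK mulg1.
apply: nt_prime_order => //.
  have -> : (s i * s i.+1) ^+ 3 = s i * s i.+1 * s i * (s i.+1 * s i * s i.+1).
    by rewrite 2!expgS expg1 !mulgA.
  rewrite -adj_tperm_braid //.
  by rewrite !mulgA !ssK adj_tpermK.
apply/eqP => /permP/(_ (inord i)); rewrite perm1 permM !tpermL => /eqP.
by rewrite eq_inord //; lia.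
Qed.

(** In a cyclic group the two subgroups of order 3 would coincide, but only the first 3-cycle fixes
    the point 3. *)
Lemma noncyclic_3cycles : ~~ cyclic <<[set s 0 * s 1; s 3 * s 4]>>.
Proof.
apply/negP=> cyc; have m_gt1 : 1 < m by apply: leq_trans m_ge5.
have /eqP E : <[s 0 * s 1]> == <[s 3 * s 4]>.
  rewrite (eq_subG_cyclic cyc) ?cycle_subG ?mem_gen ?set21 ?set22 //.
  by rewrite -!orderE !order_adj_tpermM.
have : s 3 * s 4 \in 'C[inord 3 : 'I_m.+1 | 'P].
  have : s 3 * s 4 \in <[s 0 * s 1]> by rewrite E cycle_id.
  apply/subsetP; rewrite cycle_subG; apply/astab1P.
  by rewrite /= apermE permM !tpermD // eq_inord //; lia.
move/astab1P; rewrite /= apermE permM tpermL tpermL => /eqP.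
by rewrite eq_inord //; lia.
Qed.

(** Conjugation by s_3 fixes the first 3-cycle and inverts the second. *)
Lemma deep_adj_3cycles (hT : finGroupType) (H : {group hT}) (f : {morphism H >-> 'S_m.+1}) :
    f @* H = [set: 'S_m.+1] -> 'ker f \subset 'Z(H) ->
  deep_adj f (s 0 * s 1) (s 3 * s 4).
Proof.
move=> fH kerZ.
have sC i j : i.+1 < j -> j < 5 -> commute (s i) (s j).
  by move=> ltij ltj; apply: adj_tperm_comm => //; apply: leq_trans m_ge5.
apply: (deep_adj_inv fH kerZ (g := s 3)).
- by apply: commuteM; apply/commute_sym; apply: commuteM; apply/commute_sym/sC.
- by rewrite -(@order_adj_tpermM 0) ?expg_order //; apply: leq_trans m_ge5.
- by apply/conjg_fixP/commgP/commute_sym; apply: commuteM; apply/commute_sym/sC.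
by rewrite invMg !adj_tpermV conjgE -mulgA mulKg.
Qed.

End SixPoints.

(** * Edge sets *)

Section Edges.

Variables (T : finType) (r : rel T).

Lemma mem_edges x y : symmetric r -> ([set x; y] \in edges r) = (x != y) && r x y.
Proof.
move=> rC; rewrite inE; apply/existsP/andP => [[x'] | [ne rxy]]; last first.
  by exists x; apply/existsP; exists y; rewrite ne rxy eqxx.
case/existsP=> y' /and3P[ne rxy /eqP e].
have : y' \in [set x; y] by rewrite e set22.
have : x' \in [set x; y] by rewrite e set21.
case/set2P=> xE /set2P[] yE; move: ne rxy; rewrite xE yE ?eqxx // eq_sym rC.
by [].
Qed.

Lemma edges_sub (r' : rel T) :
  (forall x y, x != y -> r x y -> r' x y) -> edges r \subset edges r'.
Proof.
move=> rr'; apply/subsetP=> e; rewrite !inE.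
case/existsP=> x /existsP[y /and3P[ne rxy /eqP->]].
by apply/existsP; exists x; apply/existsP; exists y; rewrite ne rr' ?eqxx.
Qed.

End Edges.

(** * Comparison of the three graphs *)

Lemma deep_adj_proper_comm m (hT : finGroupType) (H : {group hT})
    (f : {morphism H >-> 'S_m.+1}) : 3 <= m -> schur_cover [set: 'S_m.+1] f ->
  edges (deep_adj f) \proper edges (@comm_adj 'S_m.+1).
Proof.
move=> m_ge3 cover; have [[fH /subsetIP[kerZ _]] _] := cover.
apply/properP; split.
  by apply: edges_sub => x y _ /(deep_adj_comm fH kerZ)/eqP.
have m_gt2 : 2 < m by [].
exists [set adj_tperm m 0; adj_tperm m 2]; rewrite mem_edges.
- rewrite /comm_adj adj_tperm_comm // eqxx andbT.
  apply/eqP => /(congr1 (fun g : 'S_m.+1 => g (inord 0))).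
  by rewrite tpermL tpermD; [move/eqP| |]; rewrite ?eq_inord //; lia.
- by move=> x y; rewrite /comm_adj eq_sym.
- by rewrite (negPf (schur_cover_not_deep m_ge3 cover)) andbF.
exact: deep_adj_sym.
Qed.

Lemma epow_adj_sub_deep m (hT : finGroupType) (H : {group hT})
    (f : {morphism H >-> 'S_m.+1}) : schur_cover [set: 'S_m.+1] f ->
  edges (@epow_adj 'S_m.+1) \subset edges (deep_adj f).
Proof.
move=> [[fH /subsetIP[kerZ _]] _]; apply: edges_sub => x y _.
exact: deep_adj_cyclic.
Qed.

(** An adjacent pair makes all elements of its generated group pairwise adjacent. If that group is
    noncyclic, the five-point analysis yields adjacent disjoint transpositions, directly or by the
    swap argument, which a Schur cover excludes. *)
Lemma deep_adj_sub_epow m (hT : finGroupType) (H : {group hT})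
    (f : {morphism H >-> 'S_m.+1}) : 3 <= m <= 4 -> schur_cover [set: 'S_m.+1] f ->
  edges (deep_adj f) \subset edges (@epow_adj 'S_m.+1).
Proof.
case/andP=> m_ge3 m_le4 cover; have [[fH /subsetIP[kerZ _]] _] := cover.
apply: edges_sub => x y _ deepxy; apply: contraT => ncyc.
have deepA := deep_adj_gen fH kerZ deepxy.
have cA : abelian <<[set x; y]>>.
  by apply/centsP=> u Au v Av; apply: (deep_adj_comm fH kerZ); apply: deepA.
have leT5 : #|'I_m.+1| <= 5 by rewrite card_ord.
have [a [b [c [d [U tA]]]]] := noncyclic_abelian_5 leT5 cA ncyc.
suff deepab : deep_adj f (tperm a b) (tperm c d).
  case/negP: (schur_cover_not_deep m_ge3 cover).
  by apply: (deep_adj_disjoint_tperm fH kerZ U) deepab; apply: uniq_inord4.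
case: tA => [[Aab Acd] | [Aabcd [v Av [vv va vb]]]]; first exact: deepA.
by apply: (deep_adj_swap fH kerZ vv); [rewrite tpermJ va vb | apply: deepA].
Qed.

Theorem theorem5p18 :
  (forall n : nat, (n == 4) || (n == 5) ->
     forall (hT : finGroupType) (H : {group hT})
            (f : {morphism H >-> 'S_n}),
       schur_cover [set: 'S_n] f ->
       edges (@epow_adj 'S_n) = edges (deep_adj f) /\
       edges (deep_adj f) \proper edges (@comm_adj 'S_n)) /\
  (forall n : nat, 6 <= n ->
     forall (hT : finGroupType) (H : {group hT})
            (f : {morphism H >-> 'S_n}),
       schur_cover [set: 'S_n] f ->
       edges (@epow_adj 'S_n) \proper edges (deep_adj f) /\
       edges (deep_adj f) \proper edges (@comm_adj 'S_n)).
Proof.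
(* The degree is [n = m + 1], so the ranges become [3 <= m <= 4] and [5 <= m]. *)
split=> -[//|m] m_range hT H f cover.
  have m34 : 3 <= m <= 4 by move: m_range; rewrite !eqSS => /orP[]/eqP->.
  split; last by apply: deep_adj_proper_comm cover; case/andP: m34.
  apply/eqP; rewrite eqEsubset; apply/andP.
  by split; [exact: epow_adj_sub_deep | exact: deep_adj_sub_epow].
have m_ge3 : 3 <= m by apply: (leq_trans (n := 5)).
split; last exact: deep_adj_proper_comm cover.
apply/properP; split; first exact: epow_adj_sub_deep.
have [[fH /subsetIP[kerZ _]] _] := cover.
(* The 3-cycles on {0, 1, 2} and {3, 4, 5} give the edge separating the two graphs. *)
pose x := adj_tperm m 0 * adj_tperm m 1; pose y := adj_tperm m 3 * adj_tperm m 4.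
exists [set x; y]; rewrite mem_edges.
- rewrite deep_adj_3cycles // andbT; apply/eqP => xy.
  by have := noncyclic_3cycles m_range; rewrite -/x -/y xy setUid cycle_cyclic.
- exact: deep_adj_sym.
- by rewrite /epow_adj (negPf (noncyclic_3cycles m_range)) andbF.
by move=> u v; rewrite /epow_adj setUC.
Qed.
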